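(* Let $r\ge 1$ and let $\ell_1,\dots,\ell_r$ be positive integers. Let $c\colon E(\vec{K}_{\mathbb{N}})\to\{1,\dots,r+1\}$ be an edge-colouring of $\vec{K}_{\mathbb{N}}$ such that for every $i\in\{1,\dots,r\}$ there is no directed path of length $\ell_i$ all of whose edges have colour $i$. Moreover, assume that every directed path all of whose edges have colour $r+1$ has upper density at most $\prod_{i=1}^{r}\frac{1}{\ell_i}$. Then there exist a cube partition $\mathcal{U}$ of $\mathbb{N}$ of order $(\ell_1,\dots,\ell_r)$, each of whose partition classes has upper density $\prod_{i=1}^r\frac1{\ell_i}$, and a finite set $F\subseteq\mathbb{N}$ such that $c_{\mathcal{U}}=c$ on $D_{\mathcal{U}}-F$; that is, $c(m,n)=c_{\mathcal{U}}(m,n)$ for every edge $(m,n)$ of the slide digraph $D_{\mathcal{U}}$ with $m,n\notin F$, where $c_{\mathcal{U}}$ is the cube colouring associated with $\mathcal{U}$.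
   Context: $\mathbb{N}$ denotes the positive integers. $\vec{K}_{\mathbb{N}}$ is the complete symmetric digraph on $\mathbb{N}$: its edges are all ordered pairs $(m,n)$ of distinct positive integers. The upper density of $A\subseteq\mathbb{N}$ is $\bar d(A)=\limsup_{n\to\infty}\frac{|A\cap\{1,\dots,n\}|}{n}$, and the upper density of a path is that of its vertex set. A directed path is a finite or one-way infinite sequence of distinct vertices $v_1v_2\dots$ together with edges joining consecutive vertices, all oriented in the same direction (all edges $(v_i,v_{i+1})$, or all edges $(v_{i+1},v_i)$). The length of a path is its number of edges. Cube partition: a cube partition of $\mathbb{N}$ of order $(\ell_1,\dots,\ell_r)$ is a partition $\mathcal{U}=(U_{i_1,\dots,i_r})$ of $\mathbb{N}$ indexed by the tuples $(i_1,\dots,i_r)\in\prod_{k=1}^r\{0,\dots,\ell_k-1\}$. Cube colouring: for a cube partition $\mathcal{U}$, the colouring $c_{\mathcal{U}}\colon E(\vec{K}_{\mathbb{N}})\to\{1,\dots,r+1\}$ is defined as follows. If $m\neq n$ lie in the same class of $\mathcal{U}$, then $(m,n)$ and $(n,m)$ both get colour $r+1$. If $m\in U_{i_1,\dots,i_r}$ and $n\in U_{j_1,\dots,j_r}$ lie in different classes, let $k=\min\{k'\in\{1,\dots,r\}: i_{k'}\neq j_{k'}\}$ and name $m,n$ so that $i_k<j_k$; then $(m,n)$ gets colour $r+1$ and $(n,m)$ gets colour $k$. Slide digraph: for a cube partition $\mathcal{U}$, $D_{\mathcal{U}}$ is the digraph on $\mathbb{N}$ in which a pair $(m,n)$ of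 distinct integers $m\in U_{i_1,\dots,i_r}$, $n\in U_{j_1,\dots,j_r}$ is an edge if and only if either (1) there is an index $k$ such that $i_k>j_k$ and $i_{k'}=j_{k'}$ for all $k'\neq k$, or (2) $i_k\le j_k$ for every $k\in\{1,\dots,r\}$. *)

(* Defs.v *)
From mathcomp Require Import all_boot all_order all_algebra.
From mathcomp Require Import all_classical all_reals all_analysis.

Set Implicit Arguments.
Unset Strict Implicit.
Unset Printing Implicit Defensive.

Import Order.TTheory GRing.Theory Num.Theory.

Local Open Scope classical_set_scope.
Local Open Scope ring_scope.

Notation posN := {n : nat | (0 < n)%N}.

Definition posN_succ (k : nat) : posN := exist (fun n => (0 < n)%N) k.+1 isT.

(* |A /\ {1, ..., n}|: as k runs over {0, ..., n-1}, posN_succ k runs over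
   {1, ..., n}. *)
Definition count_upto (A : set posN) (n : nat) : nat :=
  #|[pred k : 'I_n | `[< A (posN_succ k) >]]|.

(* The term at n = 0 is 0 / 0 = 0 and does not affect the limit superior. *)
Definition upper_density (R : realType) (A : set posN) : \bar R :=
  limn_esup (fun n => ((count_upto A n)%:R / n%:R : R)%:E).

Inductive vertex_seq : Type :=
  | FinSeq of seq posN
  | InfSeq of (nat -> posN).

Definition vertices (P : vertex_seq) : set posN :=
  match P with
  | FinSeq s => [set x | x \in s]
  | InfSeq v => range v
  end.

(* P is a directed path all of whose edges satisfy e.  The edges are either all
   oriented along the sequence or all against it. *)
Definition directed_path (e : rel posN) (P : vertex_seq) : Prop :=
  match P with
  | FinSeq s => [/\ s != [::], uniq s &
      sorted e s \/ sorted (fun x y => e y x) s]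
  | InfSeq v => injective v /\
      ((forall k, e (v k) (v k.+1)) \/ (forall k, e (v k.+1) (v k)))
  end.

(* Number of edges; None for infinite paths. *)
Definition path_length (P : vertex_seq) : option nat :=
  match P with
  | FinSeq s => Some (size s).-1
  | InfSeq _ => None
  end.

(* Colours are shifted by one: the colour k of {1, ..., r} is encoded by the
   ordinal k - 1, and the colour r + 1 by ord_max.  The diagonal values c n n
   carry no meaning and are never used: vertices of a path are distinct, and so
   are the endpoints of an edge of the slide digraph. *)
Definition edge_colouring (r : nat) := posN -> posN -> 'I_r.+1.

Definition low_colour (r : nat) (k : 'I_r) : 'I_r.+1 := widen_ord (leqnSn r) k.

Definition mono_dipath (r : nat) (c : edge_colouring r) (a : 'I_r.+1)
    (P : vertex_seq) : Prop :=
  directed_path (fun x y => c x y == a) P.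

Definition cube (r : nat) (l : 'I_r -> nat) :=
  {dffun forall k : 'I_r, 'I_(l k)}.

(* A partition of the positive integers indexed by the cube is given by the map
   sending each integer to the index of its class. *)
Definition cube_partition (r : nat) (l : 'I_r -> nat) := posN -> cube l.

Definition cube_class (r : nat) (l : 'I_r -> nat) (U : cube_partition l)
    (i : cube l) : set posN := [set n | U n = i].

Definition first_differing (r : nat) (l : 'I_r -> nat) (i j : cube l) :
    option 'I_r :=
  [pick k : 'I_r | (i k != j k) &&
                   [forall k' : 'I_r, (k' < k)%N ==> (i k' == j k')]].

Definition cube_colouring (r : nat) (l : 'I_r -> nat) (U : cube_partition l) :
    edge_colouring r :=
  fun m n =>
    match first_differing (U m) (U n) with
    | None => ord_max
    | Some k => if (U m k < U n k)%N then ord_max else low_colour k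
    end.

Definition slide_edge (r : nat) (l : 'I_r -> nat) (U : cube_partition l)
    (m n : posN) : Prop :=
  m <> n /\
  ((exists k : 'I_r, (U n k < U m k)%N /\
      forall k' : 'I_r, k' <> k -> U m k' = U n k') \/
   (forall k : 'I_r, (U m k <= U n k)%N)).

(* Main.v *)
(** Every colour [k <= r] spans a digraph without paths of length [l_k], so by
    Gallai-Roy it has a proper vertex colouring with [l_k] colours.  The product
    of these colourings splits the positive integers into [L = prod l_k] classes
    inside which all edges have colour [r + 1]; each class lies on one ray of
    that colour, so it has upper density at most [1 / L], hence exactly [1 / L].
    If two classes were joined by infinitely many disjoint edges of colour
    [r + 1] in both directions, a ray would cover their union, which is too
    dense; so outside a finite set one direction has no such edges.

    On a line of the cube in direction [k] the surviving colour is then [k], and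
    one gets a tournament on the [l_k] classes of the line.  By Redei it has a
    Hamiltonian path; relabel the [k]-th coordinate of each class by its position
    on the path of its line.  An edge [x, y] of colour [k] must strictly decrease
    this label: otherwise follow the path of the line of [x] up to [x], then the
    edge, then the path of the line of [y] from [y] on, and obtain a path of
    length [l_k].  For a partition with this monotonicity the claim is immediate,
    after applying the density argument once more. *)

Require Import Defs.
From mathcomp Require Import all_boot all_order all_algebra.
From mathcomp Require Import all_classical all_reals all_analysis.
From mathcomp Require Import lra zify.

Import Order.TTheory GRing.Theory Num.Theory.

Local Open Scope classical_set_scope.
Local Open Scope ring_scope.

(** * Acyclic digraphs and the Gallai-Roy theorem *)

Section GallaiRoy.
Variables (T : eqType).
Implicit Types (E : set (T * T)) (x y : T) (s : seq T).

Definition set_rel E : rel T := fun x y => `[< E (x, y) >].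

Definition acyclic E : Prop :=
  forall x s, path (set_rel E) x s -> last x s = x -> s = [::].

Lemma acyclic_path_uniq E x s :
  acyclic E -> path (set_rel E) x s -> uniq (x :: s).
Proof.
move=> acE; elim: s x => // y s IHs x pxs.
have /andP[_ ps] := pxs; rewrite cons_uniq IHs// andbT.
apply/negP => xs; have := pxs; case/splitPr: xs => s1 s2.
rewrite -cat1s catA cats1 cat_path => /andP[p1 _].
have := acE _ _ p1; rewrite last_rcons => /(_ erefl).
by case: (s1).
Qed.

(** A closed walk has finitely many edges, so all of them lie in one member of the chain. This is
    the chain condition for Zorn's lemma. *)
Lemma acyclic_bigcup (F : set (set (T * T))) :
  F `<=` acyclic -> total_on F subset -> acyclic (\bigcup_(X in F) X).
Proof.
move=> Fac Ftot x [//|y s] pxs lst.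
have [X [FX pX]] : exists X, F X /\ path (set_rel X) x (y :: s).
  move: pxs {lst}; elim: s x y => [|z s IHs] x y /=.
    rewrite andbT => /asboolP[X FX Xxy]; exists X; rewrite andbT.
    by split=> //; apply/asboolP.
  move=> /andP[/asboolP[X FX Xxy] /IHs[Y [FY pY]]].
  have [XY|YX] := Ftot _ _ FX FY.
    by exists Y; split=> //; apply/andP; split=> //; apply/asboolP/XY.
  exists X; split=> //; apply/andP; split; first exact/asboolP.
  by apply: sub_path pY => u v /asboolP /YX ?; apply/asboolP.
exact: Fac pX lst.
Qed.

(** The vertices that [E] reaches from [y] are closed under steps of [E'] and exclude [x]. So a
    closed walk stays among them or never meets them; either way it avoids the new edge. *)
Lemma acyclic_setU1 E x y :
  acyclic E -> x != y -> ~ (exists s, path (set_rel E) y s /\ last y s = x) ->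
  acyclic (E `|` [set (x, y)]).
Proof.
move=> acE xy nopath; set E' := _ `|` _.
pose reach z := exists s, path (set_rel E) y s /\ last y s = z.
have reach_step a b : reach a -> set_rel E' a b -> set_rel E a b /\ reach b.
  move=> ra /asboolP[Eab|[ax _]]; last by move: ra; rewrite ax.
  split; first exact/asboolP.
  have [s [ps ls]] := ra; exists (rcons s b).
  by rewrite rcons_path ps ls last_rcons; split=> //; apply/asboolP.
move=> z s pzs lz; have [rz|nrz] := pselect (reach z).
  apply: (acE z) => //; elim: s z rz pzs {lz} => //= b s IHs a ra.
  by move=> /andP[/(reach_step _ _ ra)[-> rb]] /IHs ->.
apply: (acE z) => //; rewrite -{}[X in reach X]lz in nrz.
suff: path (set_rel E) z s /\ ~ reach z by case.
elim: s z nrz pzs => //= b s IHs a nr /andP[e'ab /IHs -/(_ nr)[-> nrb]].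
have Eab : set_rel E a b.
  have /asboolP[Eab|[_ byy]] := e'ab; first exact/asboolP.
  by case: nrb; rewrite byy; exists [::].
rewrite Eab; split=> // ra; apply: nrb; have [//] := reach_step _ _ ra e'ab.
Qed.

(* Gallai-Roy: take a maximal acyclic subdigraph of [D] and colour a vertex by
   the length of a longest path of it starting there.  An edge [x, y] of [D]
   left out would close a cycle, so the subdigraph has a path from [y] to [x]. *)
Lemma Gallai_Roy (D : rel T) (l : nat) :
  (forall s, uniq s -> sorted D s -> (size s <= l)%N) ->
  exists f : T -> nat,
    (forall x, (f x < l)%N) /\ (forall x y, x != y -> D x y -> f x <> f y).
Proof.
move=> Dl.
pose P E := acyclic E /\ (forall x y, E (x, y) -> D x y).
have [|E [[acE ED] maxE]] := @Zorn_bigcup _ P.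
  move=> F FP Ftot; split; first by apply: acyclic_bigcup => // X /FP[].
  by move=> x y [X /FP[_ XD]] /XD.
have Epath x s : path (set_rel E) x s -> (size s < l)%N.
  move=> pxs; apply: (Dl (x :: s)); first exact: acyclic_path_uniq pxs.
  by apply: sub_path pxs => u v /asboolP; exact: ED.
pose reach x n := `[< exists s, path (set_rel E) x s /\ size s = n >].
have reach0 x : exists n, reach x n by exists 0%N; apply/asboolP; exists [::].
have reachl x n : reach x n -> (n <= l)%N.
  by move=> /asboolP[s [/Epath + <-]]; exact: ltnW.
pose f x := ex_maxn (reach0 x) (reachl x).
have flt x : (f x < l)%N.
  by rewrite /f; case: ex_maxnP => n /asboolP[s [/Epath + <-]].
have fpath x s : path (set_rel E) x s -> (f (last x s) + size s <= f x)%N.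
  move=> pxs; rewrite {1}/f; case: ex_maxnP => n /asboolP[s' [ps' <-]] _.
  rewrite /f; case: ex_maxnP => m _; apply; apply/asboolP; exists (s ++ s').
  by rewrite cat_path pxs size_cat addnC.
exists f; split=> // x y xy Dxy fxy.
have [Exy|nExy] := pselect (E (x, y)).
  have := fpath x [:: y]; rewrite /= andbT fxy addn1 ltnn.
  by move/(_ (asboolT Exy)).
have [[s [ps ls]]|npath] :=
    pselect (exists s, path (set_rel E) y s /\ last y s = x).
  have := fpath _ _ ps; rewrite ls fxy -[leqRHS]addn0 leq_add2l leqn0.
  by rewrite size_eq0 => /eqP s0; move: ls xy; rewrite s0 /= => ->; rewrite eqxx.
apply: (maxE (E `|` [set (x, y)])).
  by split; [exact: subsetUl|move=> /(_ (x, y)) sub; apply: nExy; apply: sub; right].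
split; first exact: acyclic_setU1.
by move=> u v [/ED//|[-> ->]].
Qed.

End GallaiRoy.

(** * Rays spanning a countable set *)

(** The ray is the limit of growing finite paths. Stage [n] heads for the element coded by [n] if it
    lies in [S] and is unvisited, and for any fresh element of [S] otherwise, so nothing in [S] is
    missed. *)
Lemma spanning_ray (T : countType) (e : rel T) (S : set T) :
  (forall X : seq T, exists y, S y /\ y \notin X) ->
  (forall (X : seq T) x y, S x -> x \in X -> S y -> y \notin X ->
    exists t, [/\ path e x t, uniq t, last x t = y &
      forall z, z \in t -> S z /\ z \notin X]) ->
  exists v : nat -> T,
    [/\ injective v, forall k, e (v k) (v k.+1) & range v = S].
Proof.
move=> Sinf ext; have [x0 [Sx0 _]] := Sinf [::].
pose good t := [/\ path e x0 t, uniq (x0 :: t) & forall z, z \in x0 :: t -> S z].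
have /choice[g gP] (nt : nat * seq T) : exists u, good nt.2 ->
    [/\ good (nt.2 ++ u), (0 < size u)%N &
     forall y, unpickle nt.1 = Some y -> S y -> y \in x0 :: nt.2 ++ u].
  case: nt => n t /=; have [tgood|] := pselect (good t); last by exists [::].
  have [pt ut St] := tgood.
  have [y [Sy yt ny]] : exists y, [/\ S y, y \notin x0 :: t &
      forall z, unpickle n = Some z -> S z -> z \notin x0 :: t -> z = y].
    have [y [Sy yt]] := Sinf (x0 :: t).
    case: (unpickle n) => [z|]; last by exists y.
    have [[Sz zt]|zno] := pselect (S z /\ z \notin x0 :: t).
      by exists z; split=> // z' [->].
    by exists y; split=> // z' [<-] Sz zt; case: zno.
  have lx : last x0 t \in x0 :: t by exact: mem_last.
  have [u [pu uu lu Su]] := ext (x0 :: t) _ y (St _ lx) lx Sy yt.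
  have yu : y \in u.
    have : y \in last x0 t :: u by rewrite -lu mem_last.
    by rewrite inE => /predU1P[yl|//]; rewrite yl lx in yt.
  exists u => _; split.
  - split; first by rewrite cat_path pt.
      rewrite -cat_cons cat_uniq ut uu andbT /=.
      by apply/hasPn => z /Su[].
    by move=> z; rewrite -cat_cons mem_cat => /orP[/St//|/Su[]].
  - by case: (u) yu.
  move=> z nz Sz; rewrite -cat_cons mem_cat.
  have [//|zt] := boolP (z \in x0 :: t).
  by rewrite (ny _ nz Sz zt) yu orbT.
pose t_ := fix t_ n := if n is m.+1 then t_ m ++ g (m, t_ m) else [::].
have tgood n : good (t_ n).
  elim: n => [|n /(gP (n, _))[]//].
  by split => // z; rewrite inE => /eqP ->.
pose w n := x0 :: t_ n.
have wS n : w n.+1 = w n ++ g (n, t_ n) by [].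
have wD n m : exists u, w (n + m)%N = w n ++ u.
  elim: m => [|m [u IHm]]; first by exists [::]; rewrite addn0 cats0.
  by rewrite addnS wS IHm -catA; eexists.
have w_size n : (n < size (w n))%N.
  elim: n => // n IHn; rewrite wS size_cat.
  have [_ g0 _] := gP (n, _) (tgood n).
  by by rewrite -addn1 leq_add.
(* Each stage adds a vertex, so [w k] has an entry at position [k], and later stages keep it. *)
pose v k := nth x0 (w k) k.
have vE n k : (k <= n)%N -> v k = nth x0 (w n) k.
  move=> kn; have [u] := wD k (n - k)%N; rewrite subnKC// => ->.
  by rewrite nth_cat w_size.
exists v; split.
- move=> i j; rewrite (vE (maxn i j)) ?leq_maxl// (vE (maxn i j) j) ?leq_maxr//.
  have [_ ut _] := tgood (maxn i j).
  move/eqP; rewrite nth_uniq// => [/eqP//||];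
  by apply: leq_ltn_trans (w_size _); rewrite ?leq_maxl ?leq_maxr.
- move=> k; rewrite (vE k.+1)// (vE k.+1 k.+1)//.
  have [/(pathP x0) pt _ _] := tgood k.+1.
  exact/pt/(w_size k.+1).
- apply/seteqP; split=> [_ [k _ <-]|y Sy].
    by have [_ _ St] := tgood k; apply: St; apply: mem_nth; exact: w_size.
  have yw : y \in w (pickle y).+1.
    have [_ _] := gP (pickle y, t_ (pickle y)) (tgood (pickle y)).
    by apply=> //=; rewrite pickleK.
  exists (index y (w (pickle y).+1)) => //.
  set i := index _ _; rewrite (vE (maxn (pickle y).+1 i)) ?leq_maxr//.
  have [u] := wD (pickle y).+1 (maxn (pickle y).+1 i - (pickle y).+1)%N.
  rewrite subnKC ?leq_maxl// => ->.
  by rewrite nth_cat index_mem yw nth_index.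
Qed.

(** * Upper density *)

Lemma limn_esup_leP (R : realType) (u : nat -> \bar R) (a : R) :
  (limn_esup u <= a%:E)%E <->
  forall e : R, 0 < e -> exists N, forall n, (N <= n)%N -> (u n <= (a + e)%:E)%E.
Proof.
rewrite limn_esup_lim; split=> [ua e e0|H].
  have : (limn (esups u) < (a + e)%:E)%E.
    by apply: le_lt_trans ua _; rewrite lte_fin ltrDl.
  rewrite (cvg_lim _ (@cvg_esups_inf _ u))// => /ereal_inf_lt[_ [N _ <-] uN].
  exists N => n Nn; apply: le_trans (ltW uN).
  by apply: ereal_sup_ubound; exists n.
apply/lee_addgt0Pr => e /H[N uN]; rewrite -EFinD.
apply: lime_le; first exact: is_cvg_esups.
exists N => // n Nn; apply: ge_ereal_sup => _ [m nm <-].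
exact/uN/(leq_trans Nn).
Qed.

Lemma upper_density_leP (R : realType) (A : set posN) (a : R) :
  (upper_density R A <= a%:E)%E <->
  forall e : R, 0 < e -> exists N, forall n, (N <= n)%N ->
    (count_upto A n)%:R <= (a + e) * n%:R.
Proof.
rewrite /upper_density; split=> [/limn_esup_leP H e e0|H].
  have [N HN] := H _ e0; exists (maxn N 1) => n.
  by rewrite geq_max => /andP[/HN + n0]; rewrite lee_fin ler_pdivrMr// ltr0n.
apply/limn_esup_leP => e /H[N HN]; exists (maxn N 1) => n.
by rewrite geq_max => /andP[/HN + n0]; rewrite lee_fin ler_pdivrMr// ltr0n.
Qed.

Lemma count_uptoE (A : set posN) (n : nat) :
  count_upto A n = (\sum_(k < n) `[< A (posN_succ k) >])%N.
Proof. by rewrite /count_upto -sum1_card big_mkcond. Qed.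

Lemma count_upto_seq (X : seq posN) (n : nat) :
  (count_upto [set` X] n <= size X)%N.
Proof.
rewrite /count_upto cardE -(size_map (fun k : 'I_n => posN_succ k)).
apply: uniq_leq_size.
  by rewrite map_inj_uniq ?enum_uniq// => i j [] /val_inj.
by move=> _ /mapP[k + ->]; rewrite mem_enum => /asboolP.
Qed.

Lemma upper_density_le_finite_diff (R : realType) (A : set posN)
    (X : seq posN) (a : R) :
  (upper_density R (A `\` [set` X]) <= a%:E)%E ->
  (upper_density R A <= a%:E)%E.
Proof.
move=> /upper_density_leP H; apply/upper_density_leP => e e0.
have e20 : 0 < e / 2 by rewrite divr_gt0.
have [N HN] := H _ e20.
(* From here on the finite set contributes at most [e / 2 * n]. *)
exists (maxn N (Num.truncn ((size X)%:R / (e / 2))).+1) => n.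
rewrite geq_max => /andP[/HN Hn Xn].
have cA : (count_upto A n <= count_upto (A `\` [set` X]) n + size X)%N.
  apply: (@leq_trans (count_upto (A `\` [set` X]) n + count_upto [set` X] n)).
    rewrite !count_uptoE -big_split /= leq_sum// => k _.
    case: asboolP => // Ak; case: asboolP => // nAXk.
    by case: asboolP => // nXk; case: nAXk; split.
  by rewrite leq_add2l count_upto_seq.
have Xe : (size X)%:R <= e / 2 * n%:R.
  rewrite mulrC -ler_pdivrMr//; apply/ltW/(lt_le_trans (truncnS_gt _)).
  by rewrite ler_nat.
apply: (@le_trans _ _ ((count_upto (A `\` [set` X]) n)%:R + (size X)%:R)).
  by rewrite -natrD ler_nat.
apply: le_trans (lerD Hn Xe) _.
by rewrite -mulrDl -addrA -splitr.
Qed.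

(** The classes outside [J] asymptotically cover at most their share of an initial segment; the
    union over [J] must cover the rest. *)
Lemma upper_density_union_ge (R : realType) (I : finType) (U : posN -> I)
    (J : {set I}) (b : R) :
  (forall i, upper_density R [set n | U n = i] <= (#|I|%:R^-1)%:E)%E ->
  (upper_density R [set n | U n \in J] <= b%:E)%E ->
  #|J|%:R / #|I|%:R <= b.
Proof.
move=> HI /upper_density_leP HJ.
have I0 : 0 < #|I|%:R :> R.
  by rewrite ltr0n; apply/card_gt0P; exists (U (posN_succ 0)).
apply/ler_addgt0Pr => e e0.
(* An error [d] is spent on the union and on each of the at most [#|I|] classes outside [J]. *)
pose d := e / #|I|.+1%:R.
have d0 : 0 < d by rewrite divr_gt0.
have [N HN] := HJ _ d0.
have /choice[M HM] i : exists M, forall n, (M <= n)%N ->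
    (count_upto [set m | U m = i] n)%:R <= (#|I|%:R^-1 + d) * n%:R.
  by have /upper_density_leP := HI i; apply.
pose n := (N + \sum_i M i).+1.
have n0 : 0 < n%:R :> R by rewrite ltr0n.
have cnt : (n <= count_upto [set m | U m \in J] n
               + \sum_(i in ~: J) count_upto [set m | U m = i] n)%N.
  rewrite count_uptoE (eq_bigr _ (fun i _ => count_uptoE _ _)) exchange_big/=.
  rewrite -big_split /= -[leqLHS]muln1 -{1}(card_ord n) -sum_nat_const.
  apply: leq_sum => k _; set u := U _; case: asboolP => //= uJ.
  rewrite (bigD1 u) /=; last by rewrite inE; apply/negP.
  by case: asboolP.
rewrite -(ler_nat R) natrD natr_sum in cnt.
have {}cnt : n%:R <= (b + d) * n%:R + (#|~: J|%:R * (#|I|%:R^-1 + d)) * n%:R.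
  apply: le_trans cnt _; apply: lerD.
    by apply: HN; rewrite /n leqW// leq_addr.
  apply: le_trans (ler_sum _ _) _.
    move=> i _; apply: (HM i n).
    by rewrite /n leqW// (leq_trans _ (leq_addl _ _))// (bigD1 i)//= leq_addr.
  by rewrite sumr_const -[_ *+ _]mulr_natl mulrA.
move: cnt; rewrite -mulrDl -[leLHS]mul1r ler_pM2r// => cnt.
have cI : #|J|%:R + #|~: J|%:R = #|I|%:R :> R by rewrite -natrD cardsC.
have JI : #|J|%:R / #|I|%:R + #|~: J|%:R / #|I|%:R = 1 :> R.
  by rewrite -mulrDl cI divff// gt_eqF.
have de : e = d * #|I|%:R + d.
  by rewrite -[X in _ + X]mulr1 -mulrDr natr1 /d divfK// pnatr_eq0.
have cd : #|~: J|%:R * d <= d * #|I|%:R.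
  by rewrite mulrC ler_pM2l// -cI lerDr.
by rewrite mulrDr in cnt; lra.
Qed.

(** A class of smaller density would violate the lower bound for the singleton [J]. *)
Lemma upper_density_class (R : realType) (I : finType) (U : posN -> I) :
  (forall i, upper_density R [set n | U n = i] <= (#|I|%:R^-1)%:E)%E ->
  forall i, upper_density R [set n | U n = i] = (#|I|%:R^-1)%:E.
Proof.
move=> HI i; apply/eqP; rewrite eq_le HI /= leNgt; apply/negP => lt.
have [b lb bI] : exists2 b : R, (upper_density R [set n | U n = i] <= b%:E)%E &
    b < #|I|%:R^-1.
  case: (upper_density _ _) lt => [b| |] //=.
    by rewrite lte_fin => bI; exists b.
  by exists (#|I|%:R^-1 - 1); rewrite ?leNye ?gtrDl ?ltrN10.
have := @upper_density_union_ge R I U [set i]%SET b HI.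
under eq_set do rewrite inE; rewrite cards1 mul1r.
have -> : [set n | U n == i] = [set n | U n = i] :> set posN.
  by apply/seteqP; split => n /eqP.
by move=> /(_ lb); rewrite leNgt bI.
Qed.

Lemma upper_density_finite (R : realType) (A : set posN) (X : seq posN) (a : R) :
  0 <= a -> A `<=` [set` X] -> (upper_density R A <= a%:E)%E.
Proof.
move=> a0 AX; apply: (@upper_density_le_finite_diff R A X).
have -> : A `\` [set` X] = set0 by rewrite setD_eq0.
apply/upper_density_leP => e e0; exists 0%N => n _.
rewrite count_uptoE big1 => [|k _]; last by case: asboolP.
by rewrite mulr_ge0// addr_ge0// ltW.
Qed.

Lemma not_finite_subset (T : choiceType) (A : set T) (X : seq T) :
  ~ A `<=` [set` X] -> exists y, A y /\ y \notin X.
Proof.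
move=> /existsNP[y /not_implyP[Ay yX]]; exists y; split=> //.
exact/negP.
Qed.

(** * Cliques covered by one ray *)

Section Rays.
Variables (R : realType) (M : rel posN) (a : R).
Hypothesis a_ge0 : 0 <= a.
Hypothesis ray_density : forall v : nat -> posN, injective v ->
  (forall k, M (v k) (v k.+1)) -> (upper_density R (range v) <= a%:E)%E.

Definition clique (A : set posN) : Prop :=
  forall x y, A x -> A y -> x != y -> M x y.

(** Encodes infinitely many pairwise disjoint edges from [A] to [B]. *)
Definition linked (A B : set posN) : Prop :=
  forall X : seq posN, exists x y,
    [/\ A x, B y, x \notin X, y \notin X & M x y].

(* A ray through all of [A `|` B] that uses the edges given by [linked] to
   switch between the two cliques. *)
Lemma upper_density_linked (A B : set posN) :
  clique A -> clique B -> A `&` B = set0 -> linked A B -> linked B A ->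
  (upper_density R (A `|` B) <= a%:E)%E.
Proof.
move=> cA cB AB lAB lBA.
have nAB x y : A x -> B y -> x != y.
  move=> Ax By; apply/eqP => xy; rewrite -xy in By.
  by have : (A `&` B) x by []; rewrite AB.
have [||v [vinj vM <-]] := @spanning_ray posN M (A `|` B); last exact: ray_density.
  move=> X; have [x [_ [Ax _ xX _ _]]] := lAB X.
  by exists x; split=> //; left.
have inside C (X : seq posN) x y : clique C -> C `<=` A `|` B -> C x ->
    x \in X -> C y -> y \notin X -> exists t, [/\ path M x t, uniq t, last x t = y &
      forall z, z \in t -> (A `|` B) z /\ z \notin X].
  move=> cC CAB Cx xX Cy yX; exists [:: y]; split=> //=.
    by rewrite andbT; apply: cC => //; apply: contraNneq yX => <-.
  by move=> z; rewrite inE => /eqP ->; split=> //; exact: CAB.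
have across C D (X : seq posN) x y : clique C -> clique D -> C `<=` A `|` B ->
    D `<=` A `|` B -> (forall u v, C u -> D v -> u != v) -> linked C D ->
    C x -> x \in X -> D y ->
    y \notin X -> exists t, [/\ path M x t, uniq t, last x t = y &
      forall z, z \in t -> (A `|` B) z /\ z \notin X].
  move=> cC cD CAB DAB nCD lCD Cx xX Dy yX.
  (* The detour is [x], [u], [v], [y]; forbidding [y] keeps [u] and [v] distinct from its end. *)
  have [u [v [Cu Dv uX vX Muv]]] := lCD (y :: X).
  rewrite !inE !negb_or in uX vX; case/andP: uX vX => uy uX /andP[vy vX].
  exists [:: u; v; y]; split=> //=.
  - rewrite Muv cC//=; last by apply: contraNneq uX => <-.
    by rewrite cD.
  - by rewrite !inE negb_or nCD//= uy vy.
  move=> z; rewrite !inE => /or3P[] /eqP -> ; split=> //.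
  - exact: CAB.
  - exact: DAB.
  - exact: DAB.
move=> X x y [Ax|Bx] xX [Ay|By] yX.
- exact: (inside A).
- exact: (across A B).
- apply: (across B A) => // u v Bu Av; rewrite eq_sym; exact: nAB.
- exact: (inside B).
Qed.

Lemma upper_density_clique (A : set posN) :
  clique A -> (upper_density R A <= a%:E)%E.
Proof.
move=> cA; have [[X AX]|Ainf] := pselect (exists X : seq posN, A `<=` [set` X]).
  exact: upper_density_finite AX.
have {}Ainf (X : seq posN) : exists y, A y /\ y \notin X.
  by apply: not_finite_subset => AX; apply: Ainf; exists X.
have [//||v [vinj vM <-]] := @spanning_ray posN M A; last exact: ray_density.
move=> X x y Ax xX Ay yX; exists [:: y]; split=> //=.
  by rewrite andbT; apply: cA => //; apply: contraNneq yX => <-.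
by move=> z; rewrite inE => /eqP ->.
Qed.

End Rays.

(** * Partitions into cliques up to a finite set *)

Section CliquePartition.
Variables (R : realType) (M : rel posN) (I : finType) (U : posN -> I).
Hypothesis ray_density : forall v : nat -> posN, injective v ->
  (forall k, M (v k) (v k.+1)) ->
  (upper_density R (range v) <= (#|I|%:R^-1)%:E)%E.
(** The exceptional set is empty for the Gallai-Roy partition and nontrivial in general for the
    relabelled one. *)
Variable F : seq posN.
Hypothesis cliqueU : forall x y, x \notin F -> y \notin F -> x != y ->
  U x = U y -> M x y.

Let I_gt0 : 0 < #|I|%:R :> R.
Proof. by rewrite ltr0n; apply/card_gt0P; exists (U (posN_succ 0)). Qed.

Let cliqueD i : clique M ([set n | U n = i] `\` [set` F]).
Proof.
by move=> x y [Ux /negP xF] [Uy /negP yF] xy; apply: cliqueU; rewrite ?Ux ?Uy.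
Qed.

Let class_le i : (upper_density R [set n | U n = i] <= (#|I|%:R^-1)%:E)%E.
Proof.
apply: (@upper_density_le_finite_diff R _ F).
by apply: (@upper_density_clique R M) => //; rewrite invr_ge0 ltW.
Qed.

Lemma clique_class_density i :
  upper_density R [set n | U n = i] = (#|I|%:R^-1)%:E.
Proof. exact: upper_density_class. Qed.

Lemma clique_class_infinite i (X : seq posN) : exists x, U x = i /\ x \notin X.
Proof.
apply: (@not_finite_subset _ [set x | U x = i]) => sub.
have := @upper_density_finite R _ X 0 (lexx 0) sub.
by rewrite clique_class_density lee_fin leNgt invr_gt0 I_gt0.
Qed.

(* Otherwise the union of two classes, whose upper density is at least
   [2 / #|I|], would be covered by a single ray. *)
Lemma clique_classes_not_linked i j : i != j ->
  ~ (linked M ([set n | U n = i] `\` [set` F]) ([set n | U n = j] `\` [set` F]) /\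
     linked M ([set n | U n = j] `\` [set` F]) ([set n | U n = i] `\` [set` F])).
Proof.
move=> ij [lij lji].
have disj : ([set n | U n = i] `\` [set` F])
    `&` ([set n | U n = j] `\` [set` F]) = set0.
  apply/seteqP; split => // x [[Ui _] [Uj _]].
  by move: ij; rewrite -Ui -Uj eqxx.
have := @upper_density_linked R M _ ray_density _ _ (cliqueD i) (cliqueD j)
  disj lij lji.
rewrite -setDUl => /upper_density_le_finite_diff dij.
have := @upper_density_union_ge R I U [set i; j]%SET (#|I|%:R^-1) class_le.
have -> : [set n | U n \in [set i; j]%SET] = [set n | U n = i] `|` [set n | U n = j].
  apply/seteqP; split => x /=; rewrite !inE.
    by move=> /orP[]/eqP; [left|right].
  by case=> ->; rewrite eqxx ?orbT.
move=> /(_ dij); rewrite cards2 ij ler_pdivrMr// mulVf ?gt_eqF//.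
by rewrite lern1.
Qed.

(** For each pair of classes, some finite set meets every edge in one direction; [F'] collects these
    sets over the finitely many pairs. *)
Lemma clique_classes_sparse : exists F' : seq posN, {subset F <= F'} /\
  forall i j, i != j ->
    (forall x y, x \notin F' -> y \notin F' -> U x = i -> U y = j -> ~~ M x y) \/
    (forall x y, x \notin F' -> y \notin F' -> U x = j -> U y = i -> ~~ M x y).
Proof.
have nlink i j : ~ linked M ([set n | U n = i] `\` [set` F])
      ([set n | U n = j] `\` [set` F]) ->
    exists X, forall x y, x \notin F ++ X -> y \notin F ++ X ->
      U x = i -> U y = j -> ~~ M x y.
  move=> /existsNP[X nX]; exists X => x y.
  rewrite !mem_cat !negb_or => /andP[xF xX] /andP[yF yX] Ux Uy.
  apply/negP => Mxy; apply: nX; exists x, y.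
  by split=> //; split=> //=; exact/negP.
have /choice[X HX] (p : I * I) : exists X, p.1 != p.2 ->
    (forall x y, x \notin F ++ X -> y \notin F ++ X ->
       U x = p.1 -> U y = p.2 -> ~~ M x y) \/
    (forall x y, x \notin F ++ X -> y \notin F ++ X ->
       U x = p.2 -> U y = p.1 -> ~~ M x y).
  case: eqVneq => [_|]; first by exists [::].
  move=> /clique_classes_not_linked /not_andP[] /nlink[X HX]; exists X => _.
    by left.
  by right.
pose F' := F ++ flatten [seq X p | p <- enum {: I * I}].
have FF' p x : x \notin F' -> x \notin F ++ X p.
  rewrite !mem_cat !negb_or => /andP[-> /= xX].
  apply: contra xX => xX; apply/flatten_mapP; exists p => //.
  by rewrite mem_enum.
exists F'; split=> [x xF|i j ij]; first by rewrite mem_cat xF.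
have [H|H] := HX (i, j) ij; [left|right] => x y /(FF' (i, j)) xX /(FF' (i, j)) yX;
exact: H.
Qed.

End CliquePartition.

(** * Lines of the cube and lifting of paths of classes *)

Lemma colourP {r : nat} (a : 'I_r.+1) :
  a = ord_max \/ exists k : 'I_r, a = low_colour k.
Proof.
have [ar|ra] := ltnP a r.
  by right; exists (Ordinal ar); apply: val_inj.
by left; apply: val_inj => /=; apply/eqP; rewrite eqn_leq ra -ltnS ltn_ord.
Qed.

Definition cube_upd {r : nat} {l : 'I_r -> nat} (i : cube l) (k : 'I_r)
  (p : 'I_(l k)) : cube l := [ffun k' => eqtype.dfwith i p k'].

Lemma cube_upd_in {r l} (i : @cube r l) k p : cube_upd i k p k = p.
Proof. by rewrite ffunE dfwith_in. Qed.

Lemma cube_upd_out {r l} (i : @cube r l) k p k' : k' != k -> cube_upd i k p k' = i k'.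
Proof. by move=> kk; rewrite ffunE dfwith_out// eq_sym. Qed.

Lemma cube_upd_id {r l} (i : @cube r l) k : cube_upd i k (i k) = i.
Proof.
apply/ffunP => k'; have [->|kk] := eqVneq k' k; first exact: cube_upd_in.
exact: cube_upd_out.
Qed.

(** Every class is infinite, so representatives are chosen greedily, each new and outside [F] and
    [X]. The start [x] is avoided only when it is listed in [X]. *)
Lemma lift_class_path (I : eqType) (U : posN -> I) (F : seq posN)
    (N : rel I) (D : rel posN) :
  (forall i (X : seq posN), exists x, U x = i /\ x \notin X) ->
  (forall x y, x \notin F -> y \notin F -> N (U x) (U y) -> D x y) ->
  forall (cs : seq I) (x : posN) (X : seq posN), x \notin F -> path N (U x) cs ->
  exists s, [/\ size s = size cs, path D x s, uniq s &
    forall z, z \in s -> z \notin X].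
Proof.
move=> Uinf ND; elim=> [|i cs IHcs] x X xF; first by exists [::].
have [y [<- yX]] := Uinf i (F ++ X).
rewrite mem_cat negb_or in yX; case/andP: yX => yF yX.
move=> /= /andP[Nxy /(IHcs y (y :: X) yF)[s [ss ps us sX]]].
exists (y :: s); split=> /=; first by rewrite ss.
- by rewrite ND.
- by rewrite us andbT; apply/negP => /sX; rewrite inE eqxx.
move=> z; rewrite inE => /predU1P[->//|/sX].
by rewrite inE negb_or => /andP[].
Qed.

(** * Ranking the classes along the lines of the cube *)

Section Ranking.
Variables (r : nat) (l : 'I_r -> nat) (c : edge_colouring r).
Hypothesis c_short : forall k s, uniq s ->
  sorted (fun x y => c x y == low_colour k) s -> (size s <= l k)%N.
Variables (U : posN -> cube l) (F : seq posN).
Hypothesis U_inf : forall i (X : seq posN), exists x, U x = i /\ x \notin X.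
Hypothesis U_proper : forall k x y, x != y -> c x y = low_colour k ->
  U x k <> U y k.
Hypothesis U_sparse : forall i j, i != j ->
  (forall x y, x \notin F -> y \notin F -> U x = i -> U y = j ->
     c x y != ord_max) \/
  (forall x y, x \notin F -> y \notin F -> U x = j -> U y = i ->
     c x y != ord_max).

(** All edges outside [F] are required to have colour [k], so that a path of classes lifts through
    arbitrary representatives. *)
Definition class_edge (k : 'I_r) : rel (cube l) := fun i j =>
  `[< forall x y, x \notin F -> y \notin F -> U x = i -> U y = j ->
      c x y = low_colour k >].

(** The diagonal is included because [total] demands reflexivity. *)
Definition line_le (i : cube l) (k : 'I_r) : rel 'I_(l k) := fun p q =>
  (p == q) || class_edge k (cube_upd i k p) (cube_upd i k q).

(** Classes on a line differ only in coordinate [k], so by [U_proper] edges between them have colour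
    [k] or the top colour; [U_sparse] rules out the latter in one direction. *)
Lemma line_le_total i k : total (line_le i k).
Proof.
have nonmax p q x y : p != q -> U x = cube_upd i k p ->
    U y = cube_upd i k q -> c x y != ord_max -> c x y = low_colour k.
  move=> pq Ux Uy; have [->|[k' ck']] := colourP (c x y).
    by rewrite eqxx.
  have xy : x != y.
    apply: contra_neq pq => xy.
    by rewrite -(cube_upd_in i k p) -Ux xy Uy cube_upd_in.
  have := U_proper k' x y xy ck'; have [kk|kk] := eqVneq k' k; first by rewrite ck' kk.
  by rewrite Ux Uy !cube_upd_out//; case.
move=> p q; rewrite /line_le; have [//|pq] := eqVneq p q.
have upq : cube_upd i k p != cube_upd i k q.
  by apply: contra_neq pq => upq; rewrite -(cube_upd_in i k p) upq cube_upd_in.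
have [H|H] := U_sparse _ _ upq; apply/orP; [left|right];
    apply/asboolP => x y xF yF Ux Uy.
  by apply: (nonmax p q) => //; exact: H.
by apply: (nonmax q p) => //; [rewrite eq_sym|exact: H].
Qed.

(* Sorting by a total, not necessarily transitive, relation yields a
   Hamiltonian path of the tournament on the line through [i] (Redei). *)
Definition line_seq (i : cube l) (k : 'I_r) : seq 'I_(l k) :=
  sort (line_le i k) (enum 'I_(l k)).

Lemma mem_line_seq i k p : p \in line_seq i k.
Proof. by rewrite mem_sort mem_enum. Qed.

Lemma size_line_seq i k : size (line_seq i k) = l k.
Proof. by rewrite size_sort size_enum_ord. Qed.

Lemma sorted_line_seq i k :
  sorted (class_edge k) [seq cube_upd i k p | p <- line_seq i k].
Proof.
have : uniq (line_seq i k) by rewrite sort_uniq enum_uniq.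
have := sort_sorted (line_le_total i k) (enum 'I_(l k)).
rewrite -/(line_seq i k); case: (line_seq i k) => //= p s.
elim: s p => //= q s IHs p /andP[le_pq ps] /andP[]; rewrite inE negb_or.
move=> /andP[pq _] us; rewrite IHs// andbT.
by move: le_pq; rewrite /line_le (negPf pq).
Qed.

Definition line_index (i : cube l) (k : 'I_r) : nat :=
  index (i k) (line_seq i k).

Lemma line_index_lt i k : (line_index i k < l k)%N.
Proof. by rewrite -(size_line_seq i k) index_mem mem_line_seq. Qed.

Lemma line_seq_split i k : exists A B, [/\ size A = line_index i k,
  size B = (l k - (line_index i k).+1)%N &
  sorted (class_edge k) (A ++ i :: B)].
Proof.
exists [seq cube_upd i k p | p <- take (line_index i k) (line_seq i k)].
exists [seq cube_upd i k p | p <- drop (line_index i k).+1 (line_seq i k)].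
split.
- by rewrite size_map size_take size_line_seq line_index_lt.
- by rewrite size_map size_drop size_line_seq.
have := sorted_line_seq i k.
rewrite -{1}(cat_take_drop (line_index i k) (line_seq i k)).
rewrite (drop_nth (i k)); last by rewrite size_line_seq line_index_lt.
by rewrite nth_index ?mem_line_seq// map_cat /= cube_upd_id.
Qed.

(* Reach [x] along the line of its class, follow the edge to [y], and leave
   along the line of the class of [y]. *)
Lemma line_index_mono k x y : x \notin F -> y \notin F -> x != y ->
  c x y = low_colour k -> (line_index (U x) k < line_index (U y) k)%N.
Proof.
move=> xF yF xy cxy.
pose D u v := c u v == low_colour k.
have ND u v : u \notin F -> v \notin F -> class_edge k (U u) (U v) -> D u v.
  by move=> uF vF /asboolP H; apply/eqP/H.
have [A [A' [sA _ sortA]]] := line_seq_split (U x) k.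
(* Lifting starts from a prescribed vertex, so the part leading to [x] is lifted backwards from [x]
   and reversed afterwards. *)
have pA : path (fun i j => class_edge k j i) (U x) (rev A).
  have : sorted (fun i j => class_edge k j i) (rev (rcons A (U x))).
    rewrite rev_sorted -cats1.
    by have := sortA; rewrite -cat1s catA => /cat_sorted2[].
  by rewrite rev_rcons.
have [B' [B [_ sB sortB]]] := line_seq_split (U y) k.
have pB : path (class_edge k) (U y) B by case: (cat_sorted2 sortB).
have [s1 [ss1 ps1 us1 s1X]] := @lift_class_path _ U F _ (fun u v => D v u) U_inf
  (fun u v uF vF => ND v u vF uF) _ x [:: x; y] xF pA.
have [s2 [ss2 ps2 us2 s2X]] := @lift_class_path _ U F _ D U_inf ND _ y
  (x :: y :: s1) yF pB.
have us : uniq (rev (x :: s1) ++ y :: s2).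
  rewrite cat_uniq rev_uniq /= us1 us2 !andbT; apply/and3P; split.
  - by apply/negP => /s1X; rewrite inE eqxx.
  - rewrite negb_or mem_rev inE negb_or eq_sym xy /=; apply/andP; split.
      by apply/negP => /s1X; rewrite !inE eqxx orbT.
    apply/hasPn => z /s2X; rewrite mem_rev !inE !negb_or.
    by case/and3P => -> _ ->.
  by apply/negP => /s2X; rewrite !inE eqxx orbT.
have ps : sorted D (rev (x :: s1) ++ y :: s2).
  have : sorted D (rev (x :: s1)) by rewrite rev_sorted.
  have : last y (rev (x :: s1)) = x by rewrite rev_cons last_rcons.
  case: (rev _) => [/= yx|h t /= lt pt]; first by rewrite yx eqxx in xy.
  by rewrite cat_path pt lt /= ps2 andbT /D cxy.
(* There are [line_index (U x) k + 1] vertices up to [x] and [l k - line_index (U y) k] from [y] on,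
   at most [l k] in total. *)
have := c_short k _ us ps; rewrite size_cat size_rev /= ss1 ss2 size_rev sA sB.
move: (line_index_lt (U y) k); clear; lia.
Qed.

Lemma exists_ranking : exists U' : posN -> cube l, forall k x y,
  x \notin F -> y \notin F -> x != y -> c x y = low_colour k ->
  (U' y k < U' x k)%N.
Proof.
(* Positions increase along edges of colour [k], whereas the cube colouring wants a decrease. *)
exists (fun x => [ffun k => rev_ord (Ordinal (line_index_lt (U x) k))]).
move=> k x y xF yF xy cxy; rewrite !ffunE /=.
have := line_index_mono k x y xF yF xy cxy.
have := line_index_lt (U y) k; lia.
Qed.
End Ranking.

(** * The cube colouring on slide edges and the conclusion *)

Lemma card_cube (r : nat) (l : 'I_r -> nat) : #|{: cube l}| = (\prod_(k < r) l k)%N.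
Proof.
rewrite card_dep_ffun foldrE big_image /=.
by apply: eq_bigr => k _; rewrite card_ord.
Qed.

Lemma inv_card_cube (R : realType) (r : nat) (l : 'I_r -> nat) :
  \prod_(k < r) (1 / (l k)%:R) = #|{: cube l}|%:R^-1 :> R.
Proof.
rewrite card_cube natr_prod -prodfV.
by apply: eq_bigr => k _; rewrite mul1r.
Qed.

Lemma cube_colouring_line (r : nat) (l : 'I_r -> nat) (U : cube_partition l)
    (m n : posN) (k : 'I_r) :
  (U n k < U m k)%N -> (forall k' : 'I_r, k' <> k -> U m k' = U n k') ->
  cube_colouring U m n = low_colour k.
Proof.
move=> lt_nm eq_mn; rewrite /cube_colouring /first_differing.
case: pickP => [k' /andP[nk _]|/(_ k)].
  have [kk|/eqP/eq_mn kk] := eqVneq k' k; last by rewrite kk eqxx in nk.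
  by rewrite kk ltnNge (ltnW lt_nm).
rewrite -val_eqE /= gtn_eqF// => /negbT/forallPn[k'].
rewrite negb_imply => /andP[lt_k] /eqP; case; apply: eq_mn => kk.
by rewrite kk ltnn in lt_k.
Qed.

Lemma cube_colouring_le (r : nat) (l : 'I_r -> nat) (U : cube_partition l)
    (m n : posN) :
  (forall k : 'I_r, (U m k <= U n k)%N) -> cube_colouring U m n = ord_max.
Proof.
move=> le_mn; rewrite /cube_colouring /first_differing.
case: pickP => [k /andP[nk _]|//].
by rewrite ltn_neqAle le_mn val_eqE nk.
Qed.

Theorem theorem4p2 (R : realType) (r : nat) (hr : (1 <= r)%N)
    (l : 'I_r -> nat) (hl : forall k : 'I_r, (0 < l k)%N)
    (c : edge_colouring r)
    (hlow : forall k : 'I_r,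
      ~ exists P : vertex_seq,
          mono_dipath c (low_colour k) P /\ path_length P = Some (l k))
    (hhigh : forall P : vertex_seq, mono_dipath c ord_max P ->
      (upper_density R (vertices P) <= (\prod_(k < r) (1 / (l k)%:R))%:E)%E) :
  exists U : cube_partition l,
    (forall i : cube l,
      upper_density R (cube_class U i) = (\prod_(k < r) (1 / (l k)%:R))%:E) /\
    exists F : set posN, finite_set F /\
      forall m n : posN, slide_edge U m n -> ~ F m -> ~ F n ->
        c m n = cube_colouring U m n.
Proof.
rewrite inv_card_cube in hhigh *.
pose M : rel posN := fun x y => c x y == ord_max.
have ray_density v : injective v -> (forall k, M (v k) (v k.+1)) ->
    (upper_density R (range v) <= (#|{: cube l}|%:R^-1)%:E)%E.
  by move=> vinj vM; apply: (hhigh (InfSeq v)); split=> //; left.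
have c_short k s : uniq s -> sorted (fun x y => c x y == low_colour k) s ->
    (size s <= l k)%N.
  move=> us ss; rewrite leqNgt; apply/negP => ls; apply: (hlow k).
  (* Only length exactly [l k] is forbidden, so a longer path is cut to its first [l k] edges. *)
  have sz : size (take (l k).+1 s) = (l k).+1 by rewrite size_take_min; exact/minn_idPl.
  exists (FinSeq (take (l k).+1 s)); split; last by rewrite /= sz.
  split; [by rewrite -size_eq0 sz|exact: take_uniq|left; exact: take_sorted].
have /choice[f Hf] k : exists f : posN -> nat, (forall x, (f x < l k)%N) /\
    (forall x y, x != y -> c x y == low_colour k -> f x <> f y).
  exact/Gallai_Roy/c_short.
pose V x : cube l := [ffun k => Ordinal ((Hf k).1 x)].
have V_proper k x y : x != y -> c x y = low_colour k -> V x k <> V y k.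
  by move=> xy /eqP cxy; rewrite !ffunE => -[]; exact: (Hf k).2.
have V_clique x y : x \notin [::] -> y \notin [::] -> x != y -> V x = V y -> M x y.
  move=> _ _ xy Vxy; rewrite /M; have [->//|[k ck]] := colourP (c x y).
  by have := V_proper _ _ _ xy ck; rewrite Vxy.
have [F [_ V_sparse]] := clique_classes_sparse R M _ V ray_density _ V_clique.
have V_inf := clique_class_infinite R M _ V ray_density _ V_clique.
have [U U_rank] := exists_ranking _ _ c c_short V F V_inf V_proper V_sparse.
have U_le x y : x \notin F -> y \notin F -> x != y ->
    (forall k, (U x k <= U y k)%N) -> c x y = ord_max.
  move=> xF yF xy le_xy; have [//|[k ck]] := colourP (c x y).
  by have := U_rank k x y xF yF xy ck; rewrite ltnNge le_xy.
have U_clique x y : x \notin F -> y \notin F -> x != y -> U x = U y -> M x y.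
  by move=> xF yF xy Uxy; apply/eqP/U_le => // k; rewrite Uxy.
(* The density argument is repeated because the classes of [U] differ from those of [V]. *)
have [F' [FF' U_sparse]] := clique_classes_sparse R M _ U ray_density _ U_clique.
exists U; split.
  by move=> i; exact: (clique_class_density R M _ U ray_density _ U_clique).
exists [set` F']; split; first exact: finite_seq.
move=> m n [/eqP mn slide] /negP mF' /negP nF'.
have [mF nF] : m \notin F /\ n \notin F by split; apply: contra (FF' _) _.
case: slide => [[k [lt_nm eq_mn]]|le_mn]; last by rewrite cube_colouring_le// U_le.
rewrite (cube_colouring_line _ _ _ _ _ _ lt_nm eq_mn).
(* The reverse edge has the top colour, so the sparse direction must be from [m] to [n]. *)
have c_nm : c n m = ord_max.
  apply: U_le => // [|k']; first by rewrite eq_sym.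
  by have [->|/eqP/eq_mn ->//] := eqVneq k' k; exact: ltnW.
have c_mn : c m n != ord_max.
  have Umn : U m != U n by apply: contraTneq lt_nm => ->; rewrite ltnn.
  have [H|H] := U_sparse _ _ Umn; first exact: H.
  by have := H n m nF' mF' erefl erefl; rewrite /M c_nm eqxx.
have [c_max|[k' ck']] := colourP (c m n); first by rewrite c_max eqxx in c_mn.
(* Colour [k'] forces a strict drop in coordinate [k'], and the two classes differ only in
   coordinate [k]. *)
have := U_rank k' m n mF nF mn ck'.
by have [<-//|/eqP/eq_mn ->] := eqVneq k' k; rewrite ltnn.
Qed.
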